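(* Let $f_n:\mathbb{R}\to\mathbb{R}$ ($n\in\mathbb{N}$) be Borel functions such that the graph $\mathcal{G}$ on $\mathbb{R}$ given by $x\,\mathcal{G}\,y\iff\exists n\,(f_n(x)=y\ \vee\ f_n(y)=x)$ has cliques of size $\aleph_1$ but no cliques of size greater than $\aleph_1$. Let $Z\subseteq\mathbb{R}^{\mathbb{N}}$ be the set of all injective sequences of reals which enumerate a clique of $\mathcal{G}$, and let $=^+\restriction Z$ be the restriction to $Z$ of the equivalence relation $(x_n)=^+(y_n)\iff\{x_n:n\in\mathbb{N}\}=\{y_n:n\in\mathbb{N}\}$. Then $E(\mathrm{Aut}(\mathcal{N}^{\mathrm{BKL}}_2))$ is generically $(=^+\restriction Z)$-ergodic, and hence $E(\mathrm{Aut}(\mathcal{N}^{\mathrm{BKL}}_2))\not\leq_B\ (=^+\restriction Z)$.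
   Context: $\mathcal{L}_2$ is the language with countably many binary relation symbols $R_0,R_1,\dots$ and countably many binary function symbols $f_0,f_1,\dots$ (distinct from the functions $f_n$ above). $\mathcal{N}^{\mathrm{BKL}}_2$ is the (unique up to isomorphism, constructed by Baldwin–Koerwien–Laskowski) countable ultrahomogeneous $\mathcal{L}_2$-structure with domain $\mathbb{N}$ such that: (1) the substructure generated by any finite set is finite; (2) the $R_j$ partition $\mathbb{N}^2$; (3) if $R_j(a_1,a_2)$ then $f_i(a_1,a_2)=a_1$ for all $i>j$; (4) for every 3-element $A\subseteq\mathbb{N}$ there is $a\in A$ in the substructure generated by $A\setminus\{a\}$; (5) every finite $\mathcal{L}_2$-structure satisfying (1)–(4) embeds into it. For $P\leq\mathrm{Sym}(\mathbb{N})$ closed, $E(P)$ is the orbit equivalence relation of the action of $P$ on $\mathbb{R}^{\mathbb{N}}$ given by $(gx)(a)=x(g^{-1}(a))$. $E$ on $X$ is generically $F$-ergodic ($F$ on $Y$) if every Baire-measurable map $f:X\to Y$ with $x\,E\,x'\Rightarrow f(x)\,F\,f(x')$ maps a comeager subset of $X$ into a single $F$-class. $\leq_B$ denotes Borel reducibility. *)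

(* Defs.v *)
From HB Require Import structures.
From mathcomp Require Import all_boot all_order all_algebra.
From mathcomp Require Import all_classical all_reals all_analysis.
Set Implicit Arguments. Unset Strict Implicit. Unset Printing Implicit Defensive.
Import Order.TTheory GRing.Theory Num.Theory.
Local Open Scope classical_set_scope.

Section DST.
Context {T : topologicalType}.
Definition borel_set (A : set T) : Prop := <<s open >> A.
Definition nowhere_dense (A : set T) : Prop := interior (closure A) = set0.
Definition meager (A : set T) : Prop :=
  exists N : nat -> set T, (forall n, nowhere_dense (N n)) /\ A `<=` \bigcup_n N n.
Definition comeager (A : set T) : Prop := meager (~` A).
Definition baire_property (A : set T) : Prop :=
  exists U : set T, open U /\ meager ((A `\` U) `|` (U `\` A)).
End DST.

Definition borel_fun {T U : topologicalType} (f : T -> U) : Prop :=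
  forall B : set U, open B -> borel_set (f @^-1` B).
Definition baire_measurable {T U : topologicalType} (f : T -> U) : Prop :=
  forall B : set U, open B -> baire_property (f @^-1` B).

(* |A| <= aleph_1 iff A carries a well-order all of whose proper initial
   segments are countable. *)
Definition card_le_aleph1 {T : Type} (A : set T) : Prop :=
  exists lt : T -> T -> Prop,
    (forall a, A a -> ~ lt a a) /\
    (forall a b c, A a -> A b -> A c -> lt a b -> lt b c -> lt a c) /\
    (forall a b, A a -> A b -> [\/ lt a b, a = b | lt b a]) /\
    (forall B : set T, B `<=` A -> B !=set0 ->
        exists2 b, B b & forall c, B c -> ~ lt c b) /\
    (forall a, A a -> countable [set b | A b /\ lt b a]).

Definition card_eq_aleph1 {T : Type} (A : set T) : Prop :=
  card_le_aleph1 A /\ ~ countable A.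

Definition fn_graph {R : Type} (f : nat -> R -> R) (x y : R) : Prop :=
  exists n, f n x = y \/ f n y = x.

Definition clique {T : Type} (G : T -> T -> Prop) (C : set T) : Prop :=
  forall x y, C x -> C y -> x <> y -> G x y.

Definition RN (R : realType) := {ptws nat -> R}.

Definition Zset (R : realType) (f : nat -> R -> R) : set (RN R) :=
  [set x : RN R | injective x /\ clique (fn_graph f) (range x)].

Definition eqplus (R : realType) (x y : RN R) : Prop := range x = range y.

(* An L_2-structure on a carrier T: Rel j a b means R_j(a,b),
   Fun i a b = f_i(a,b). *)
Definition fclosed {T : Type} (Fun : nat -> T -> T -> T) (S : set T) : Prop :=
  forall i a b, S a -> S b -> S (Fun i a b).

Definition generated {T : Type} (Fun : nat -> T -> T -> T) (A : set T) : set T :=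
  [set x | forall S, fclosed Fun S -> A `<=` S -> S x].

Definition bkl_axioms {T : Type} (Rel : nat -> T -> T -> Prop)
    (Fun : nat -> T -> T -> T) : Prop :=
  [/\ (forall A : set T, finite_set A -> finite_set (generated Fun A)),
      (forall a b, exists! j, Rel j a b),
      (forall j a b, Rel j a b -> forall i, (j < i)%N -> Fun i a b = a) &
      (forall a b c, a <> b -> a <> c -> b <> c ->
         [\/ generated Fun [set b; c] a,
             generated Fun [set a; c] b |
             generated Fun [set a; b] c])].

Definition is_automorphism (Rel : nat -> nat -> nat -> Prop)
    (Fun : nat -> nat -> nat -> nat) (g : nat -> nat) : Prop :=
  [/\ bijective g,
      (forall j a b, Rel j a b <-> Rel j (g a) (g b)) &
      (forall i a b, g (Fun i a b) = Fun i (g a) (g b))].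

(* every isomorphism between finite (= finitely generated, by (1))
   substructures extends to an automorphism *)
Definition ultrahomogeneous (Rel : nat -> nat -> nat -> Prop)
    (Fun : nat -> nat -> nat -> nat) : Prop :=
  forall (A B : set nat) (h : nat -> nat),
    finite_set A -> finite_set B -> fclosed Fun A -> fclosed Fun B ->
    set_bij A B h ->
    (forall j a b, A a -> A b -> (Rel j a b <-> Rel j (h a) (h b))) ->
    (forall i a b, A a -> A b -> h (Fun i a b) = Fun i (h a) (h b)) ->
    exists g, is_automorphism Rel Fun g /\ forall a, A a -> g a = h a.

Definition finite_universal (Rel : nat -> nat -> nat -> Prop)
    (Fun : nat -> nat -> nat -> nat) : Prop :=
  forall (T : finType) (Rel' : nat -> T -> T -> Prop) (Fun' : nat -> T -> T -> T),
    bkl_axioms Rel' Fun' ->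
    exists e : T -> nat,
      [/\ injective e,
          (forall j x y, Rel' j x y <-> Rel j (e x) (e y)) &
          (forall i x y, e (Fun' i x y) = Fun i (e x) (e y))].

Definition is_NBKL2 (Rel : nat -> nat -> nat -> Prop)
    (Fun : nat -> nat -> nat -> nat) : Prop :=
  [/\ ultrahomogeneous Rel Fun, bkl_axioms Rel Fun & finite_universal Rel Fun].

(* E(Aut(N)) on R^N : (g x)(a) = x (g^-1 a) *)
Definition E_Aut (R : realType) (Rel : nat -> nat -> nat -> Prop)
    (Fun : nat -> nat -> nat -> nat) (x y : RN R) : Prop :=
  exists g, is_automorphism Rel Fun g /\ forall a, y (g a) = x a.

Definition generically_ergodic {X Y : topologicalType}
    (E : X -> X -> Prop) (Z : set Y) (F : Y -> Y -> Prop) : Prop :=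
  forall f : X -> Y, baire_measurable f -> (forall x, Z (f x)) ->
    (forall x x', E x x' -> F (f x) (f x')) ->
    exists C : set X, comeager C /\ forall x x', C x -> C x' -> F (f x) (f x').

Definition borel_reducible {X Y : topologicalType}
    (E : X -> X -> Prop) (Z : set Y) (F : Y -> Y -> Prop) : Prop :=
  exists f : X -> Y, borel_fun f /\ (forall x, Z (f x)) /\
    forall x x', E x x' <-> F (f x) (f x').

(* Main.v *)
Require Import Defs.
From HB Require Import structures.
From mathcomp Require Import all_boot all_order all_algebra.
From mathcomp Require Import all_classical all_reals all_analysis.
Import numFieldTopology.Exports numFieldNormedType.Exports.
Set Implicit Arguments. Unset Strict Implicit. Unset Printing Implicit Defensive.
Import Order.TTheory GRing.Theory Num.Theory.
Local Open Scope classical_set_scope.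

(** Let [phi] be a coordinate of a homomorphism [F], and let an automorphism [h]
    act by [x |-> x \o h]. The range of [F (x \o h)] is the range of [F x] and a
    clique, so [phi x] and [phi (x \o h)] are equal or related by some [f n]; as
    there are countably many options, one of them holds generically on some open
    set. By Baire category in the automorphism group, one option works on one open
    set for a dense set of [h] in some basic open set, and eliminating [f n]
    between two such [h] shows that [phi (y \o k) = phi y] generically on an open
    set for many [k] fixing a finite set [B] pointwise. By disjoint amalgamation
    such [k] can move any finite set off [B] arbitrarily far away, so [phi y] only
    depends on [y] restricted to [B]. For [k] with [k B] disjoint from [B], the
    option holding between [phi x] and [phi (x \o k)] equates functions of
    independent coordinates, hence [phi] is constant on an open set. Such constant
    values belong to the range of [F x] for generic [x], because the orbit of a
    generic [x] meets every open set, and they exhaust it. *)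

(** * Baire category in the automorphism group *)

Section Automorphisms.
Variables (Rel : nat -> nat -> nat -> Prop) (Fun : nat -> nat -> nat -> nat).

Record aut := Aut {
  fw :> nat -> nat;
  bw : nat -> nat;
  fwK : cancel fw bw;
  bwK : cancel bw fw;
  fw_Rel : forall j a b, Rel j a b <-> Rel j (fw a) (fw b);
  fw_Fun : forall i a b, fw (Fun i a b) = Fun i (fw a) (fw b) }.

Lemma is_automorphism_aut (g : aut) : is_automorphism Rel Fun g.
Proof.
split; [by exists (bw g); [exact: fwK|exact: bwK] | exact: fw_Rel | exact: fw_Fun].
Qed.

Lemma aut_is_automorphism g : is_automorphism Rel Fun g ->
  exists h : aut, h = g :> (nat -> nat).
Proof. by case=> -[g' gK g'K] gR gF; exists (Aut gK g'K gR gF). Qed.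

Definition aut1 : aut.
Proof. by exists id id. Defined.

Definition aut_inv (g : aut) : aut.
Proof.
exists (bw g) (fw g); [exact: bwK | exact: fwK | |].
- by move=> j a b; rewrite (fw_Rel g j (bw g a)) !bwK.
- by move=> i a b; apply: (can_inj (fwK g)); rewrite bwK fw_Fun !bwK.
Defined.

Definition aut_mul (g h : aut) : aut.
Proof.
exists (g \o h) (bw h \o bw g).
- exact: can_comp (fwK g) (fwK h).
- exact: can_comp (bwK h) (bwK g).
- by move=> j a b; rewrite (fw_Rel h j a b) (fw_Rel g j (h a)).
- by move=> i a b /=; rewrite !fw_Fun.
Defined.

(* Basic neighbourhoods for pointwise convergence of automorphisms together with
   their inverses, a completely metrizable topology. *)
Definition agree (m : nat) (g h : aut) :=
  forall j, j < m -> h j = g j /\ bw h j = bw g j.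

Lemma agree_refl m g : agree m g g. Proof. by []. Qed.

Lemma agree_trans m g h k : agree m g h -> agree m h k -> agree m g k.
Proof. by move=> gh hk j jm; rewrite !(hk j jm).1 !(hk j jm).2; exact: gh. Qed.

Lemma agreeW {m n g h} : m <= n -> agree n g h -> agree m g h.
Proof. by move=> mn gh j jm; apply: gh; exact: leq_trans jm mn. Qed.

Lemma agree_inv m g h : agree m g h -> agree m (aut_inv g) (aut_inv h).
Proof. by move=> gh j /gh[]. Qed.

(** The value at [j] is settled from stage [j.+1] on, because [j < m j.+1]. As [agree] also controls
    inverses, the limit is bijective. *)
Lemma aut_limit (g : nat -> aut) (m : nat -> nat) :
  (forall k, k <= m k) -> (forall k, m k <= m k.+1) ->
  (forall k, agree (m k) (g k) (g k.+1)) ->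
  exists h : aut, forall k, agree (m k) (g k) h.
Proof.
move=> km mS gS.
have agr k l : k <= l -> agree (m k) (g k) (g l).
  move=> kl; rewrite -(subnKC kl); elim: (l - k) => [|d IH].
    by rewrite addn0.
  rewrite addnS; apply: agree_trans IH _; apply: agreeW (gS _).
  by elim: d => [|d IH]; rewrite ?addn0 // addnS; exact: leq_trans IH (mS _).
pose hf j := g j.+1 j; pose hb j := bw (g j.+1) j.
have hfE k j : j < k -> hf j = g k j /\ hb j = bw (g k) j.
  by move=> jk; have [] := agr _ _ jk j (km _); rewrite /hf /hb => -> ->.
have hK : cancel hf hb.
  move=> j; set k := maxn j.+1 (hf j).+1.
  rewrite (hfE k _ (leq_maxr _ _)).2 (hfE k j (leq_maxl _ _)).1; exact: fwK.
have hbK : cancel hb hf.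
  move=> j; set k := maxn j.+1 (hb j).+1.
  rewrite (hfE k _ (leq_maxr _ _)).1 (hfE k j (leq_maxl _ _)).2; exact: bwK.
have hR j a b : Rel j a b <-> Rel j (hf a) (hf b).
  set k := maxn a.+1 b.+1.
  by rewrite (hfE k a (leq_maxl _ _)).1 (hfE k b (leq_maxr _ _)).1; exact: fw_Rel.
have hF i a b : hf (Fun i a b) = Fun i (hf a) (hf b).
  set k := maxn (Fun i a b).+1 (maxn a.+1 b.+1).
  have ka : a < k by rewrite !leq_max leqnn orbT.
  have kb : b < k by rewrite !leq_max leqnn !orbT.
  by rewrite (hfE k a ka).1 (hfE k b kb).1 (hfE k _ (leq_maxl _ _)).1 fw_Fun.
exists (Aut hK hbK hR hF) => k j jk /=.
have [h1 h2] := agr _ _ (leq_maxl k j.+1) j jk.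
by rewrite (hfE _ _ (leq_maxr k j.+1)).1 (hfE _ _ (leq_maxr k j.+1)).2 h1 h2.
Qed.

Definition agree_dense (Gam : set aut) m g :=
  forall g' m', agree m g g' -> exists2 h, Gam h & agree m' g' h.

(** Otherwise every neighbourhood within the given one has a smaller one missing [Gam i]; treating
    all [i] in turn yields a limit in no [Gam i]. *)
Lemma aut_baire (I : countType) (Gam : I -> set aut) g0 m0 :
  (forall h, agree m0 g0 h -> exists i, Gam i h) ->
  exists i g m, [/\ m0 <= m, agree m0 g0 g & agree_dense (Gam i) m g].
Proof.
move=> cov; apply: contrapT => nex.
have step (i : option I) g m : m0 <= m -> agree m0 g0 g ->
    exists g' m', [/\ m < m', agree m g g' &
      if i is Some i then forall h, agree m' g' h -> ~ Gam i h else True].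
  case: i => [i|] mm gg; last by exists g, m.+1.
  have : ~ agree_dense (Gam i) m g by move=> gd; apply: nex; exists i, g, m.
  move=> /existsNP[g' /existsNP[m' /not_implyP[gg' nh]]].
  exists g', (maxn m.+1 m'); split=> //; first exact: leq_maxl.
  by move=> h g'h Gh; apply: nh; exists h => //; apply: agreeW g'h; exact: leq_maxr.
pose ok (p : aut * nat) := m0 <= p.2 /\ agree m0 g0 p.1.
have /choice[F FP] (q : nat * {p | ok p}) : exists r : {p | ok p},
    [/\ (sval q.2).2 < (sval r).2, agree (sval q.2).2 (sval q.2).1 (sval r).1 &
     if unpickle q.1 is Some i then
       forall h, agree (sval r).2 (sval r).1 h -> ~ Gam i h else True].
  case: q => k [[g m] /= [mm gg]]; have [g' [m' [mm' gg' H]]] := step (unpickle k) g m mm gg.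
  have okr : ok (g', m').
    split; first exact: leq_trans mm (ltnW mm').
    by apply: agree_trans gg _; exact: agreeW gg'.
  by exists (exist _ (g', m') okr).
have ok0 : ok (g0, m0) by [].
pose s := fix s k := if k is k'.+1 then F (k', s k') else exist _ (g0, m0) ok0.
have sP k := FP (k, s k).
have [h hP] : exists h, forall k, agree (sval (s k)).2 (sval (s k)).1 h.
  apply: (@aut_limit (fun k => (sval (s k)).1) (fun k => (sval (s k)).2)).
  - by elim=> [|k IH]//; have [+ _ _] := sP k; exact: leq_ltn_trans.
  - by move=> k; have [+ _ _] := sP k; exact: ltnW.
  - by move=> k; have [_ + _] := sP k.
have [i Gi] := cov h (hP 0).
by have [_ _] := sP (pickle i); rewrite /= pickleK => /(_ h (hP _.+1)).
Qed.

End Automorphisms.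

(** * Finite substructures and disjoint amalgamation *)

Lemma fclosed_generated {T : Type} (Fun : nat -> T -> T -> T) (A : set T) :
  Defs.fclosed Fun (generated Fun A).
Proof. move=> i a b Sa Sb S cS AS; exact: (cS i a b (Sa S cS AS) (Sb S cS AS)). Qed.

Lemma sub_generated {T : Type} (Fun : nat -> T -> T -> T) (A : set T) :
  A `<=` generated Fun A.
Proof. by move=> x Ax S _; apply. Qed.

Lemma finite_set_bound (E : set nat) : finite_set E -> exists M, forall a, E a -> a < M.
Proof.
move=> /finite_fsetP[X ->]; exists (\max_(i <- finmap.enum_fset X) i).+1 => a /= aX.
by rewrite ltnS (big_rem a) //= leq_maxl.
Qed.

Section Amalgamation.
Variables (Rel : nat -> nat -> nat -> Prop) (Fun : nat -> nat -> nat -> nat).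
Hypothesis hN : is_NBKL2 Rel Fun.

Lemma finite_generated (A : set nat) : finite_set A -> finite_set (generated Fun A).
Proof. by case: hN => _ [+ _ _ _] _; exact. Qed.

Lemma embedding_extends (E : set nat) (h : nat -> nat) :
  finite_set E -> Defs.fclosed Fun E -> {in E &, injective h} ->
  (forall j a b, E a -> E b -> (Rel j a b <-> Rel j (h a) (h b))) ->
  (forall i a b, E a -> E b -> h (Fun i a b) = Fun i (h a) (h b)) ->
  exists g : aut Rel Fun, forall a, E a -> g a = h a.
Proof.
case: hN => uh _ _ finE cE hI hR hF.
have [g [/aut_is_automorphism[k <-] gh]] : exists g, is_automorphism Rel Fun g /\
    forall a, E a -> g a = h a.
  apply: (uh E (h @` E)) => //; first exact: finite_image.
    by move=> i _ _ [a Ea <-] [b Eb <-]; exists (Fun i a b); [exact: cE|exact: hF].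
  exact: inj_bij.
by exists k.
Qed.

Section TwoCopies.
Variables (B E : set nat) (M a0 : nat).
Hypotheses (cB : Defs.fclosed Fun B) (cE : Defs.fclosed Fun E) (BE : B `<=` E).
Hypotheses (EM : forall a, E a -> a < M.+1) (Ea0 : E a0).

(* The pair (s, a) is the copy of a in the s-th copy of E; the elements of B
   occur only with s = false. *)
Let twoE (p : bool * 'I_M.+1) := `[< E p.2 >] && (p.1 ==> ~~ `[< B p.2 >]).
Let T : finType := {p | twoE p}.

Let t0P : twoE (false, inord a0).
Proof. by rewrite /twoE /= andbT inordK ?EM //; apply/asboolP. Qed.
Let t0 : T := @exist _ (fun p => twoE p) _ t0P.

Let proj (p : T) : nat := (val p).2.
Let side (s : bool) (p : T) := if s then (val p).1 || `[< B (proj p) >] else ~~ (val p).1.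
Let copy (s : bool) (a : nat) : T := insubd t0 (s && ~~ `[< B a >], inord a).

Let E_proj p : E (proj p).
Proof. by have /andP[/asboolP] := valP p. Qed.

Let val_copy s a : E a -> val (copy s a) = (s && ~~ `[< B a >], inord a).
Proof.
move=> Ea; rewrite /copy val_insubd /twoE /= inordK ?EM //.
rewrite (asboolT Ea) /=; case: ifP => //.
by case: s => //=; rewrite implybb.
Qed.

Let copyK s a : E a -> proj (copy s a) = a.
Proof. by move=> Ea; rewrite /proj val_copy //= inordK ?EM. Qed.

Let side_copy s a : E a -> side s (copy s a).
Proof.
move=> Ea; rewrite /side copyK // val_copy //=.
by case: s => //=; rewrite orNb.
Qed.

Let projK s p : side s p -> copy s (proj p) = p.
Proof.
move=> sp; apply: val_inj; rewrite val_copy; last exact: E_proj.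
rewrite (_ : inord (proj p) = (val p).2); last by apply: ord_inj; rewrite inordK ?EM.
rewrite [RHS]surjective_pairing; congr pair.
have /andP[_] := valP p; move: sp; rewrite /side /proj.
case: s; first by case: (val p).1 => //= -> .
by move=> /negbTE ->.
Qed.

Let copyB s b : B b -> copy s b = copy false b.
Proof. by move=> Bb; apply: val_inj; rewrite !val_copy ?asboolT ?andbF; auto. Qed.

(** [None] marks a crossing pair. Preferring [false] is harmless: two points on both sides lie over
    [B], where the copies coincide. *)
Let both p q := if side false p && side false q then Some false
  else if side true p && side true q then Some true else None.

(* A pair whose members lie in different copies generates everything, which
   yields axiom (4). *)
Let Rel2 j (p q : T) := if both p q is Some _ then Rel j (proj p) (proj q) else j = #|T|.
Let Fun2 i (p q : T) := if both p q is Some s then copy s (Fun i (proj p) (proj q))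
  else nth p (enum T) i.

Let Rel2_side s j p q : side s p -> side s q -> Rel2 j p q = Rel j (proj p) (proj q).
Proof. by rewrite /Rel2 /both; case: s => -> -> //; case: ifP. Qed.

Let Fun2_side s i p q : side s p -> side s q ->
  Fun2 i p q = copy s (Fun i (proj p) (proj q)).
Proof.
move=> sp sq; rewrite /Fun2 /both; case: s sp sq => [sp sq|-> -> //].
case: ifP => [/andP[fp fq]|_]; last by rewrite sp sq.
have sideB x : side true x -> side false x -> B (proj x).
  by rewrite /side => /orP[->//|/asboolP].
by rewrite [RHS]copyB //; apply: cB; apply: sideB.
Qed.

Let fclosed_copy s S : Defs.fclosed Fun2 S ->
  Defs.fclosed Fun [set x | E x /\ S (copy s x)].
Proof.
move=> cS i x y [Ex Sx] [Ey Sy]; split; first exact: cE.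
have := cS i _ _ Sx Sy.
by rewrite (@Fun2_side s) ?copyK //; apply: side_copy.
Qed.

(** A closed subset of the amalgam pulls back along a copy to a closed subset of [E], so axiom (4)
    is inherited within one copy. *)
Let generated_side s p q r : side s p -> side s q -> side s r ->
  generated Fun [set proj q; proj r] (proj p) -> generated Fun2 [set q; r] p.
Proof.
move=> sp sq sr gen S cS qrS.
have := gen _ (@fclosed_copy s S cS); rewrite /= projK //; case=> //.
move=> x /= [->|->]; (split; first exact: E_proj); rewrite projK //; apply: qrS; [left|right].
all: by [].
Qed.

Let generated_crossing p q r : both p q = None -> generated Fun2 [set p; q] r.
Proof.
move=> pq S cS pqS.
have Sp : S p by apply: pqS; left.
have Sq : S q by apply: pqS; right.
have := cS (index r (enum T)) _ _ Sp Sq.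
by rewrite /Fun2 pq nth_index // mem_enum.
Qed.

Let side_or p : side false p || side true p.
Proof. by rewrite /side; case: (val p).1. Qed.

Let bkl_two : bkl_axioms Rel2 Fun2.
Proof.
have [_ [_ ax2 ax3 ax4] _] := hN.
split.
- by move=> A _; exact: finite_finset.
- move=> p q; rewrite /Rel2; case: (both p q) => [s|]; first exact: ax2.
  by exists #|T|; split=> // j ->.
- move=> j p q; rewrite /Rel2 /Fun2; case E1: (both p q) => [s|].
    move=> Rpq i ji; rewrite (ax3 _ _ _ Rpq) // projK //.
    by move: E1; rewrite /both; do 2 (case: ifP => [/andP[? ?] [<-]//|_]).
  (* Past index [#|T|], the relation index of a crossing pair, [nth] returns its default, the first
     argument, as axiom (3) demands. *)
  by move=> -> i ji; rewrite nth_default // -cardE ltnW.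
- move=> a b c ab ac bc.
  have genC p q r : generated Fun2 [set p; q] r -> generated Fun2 [set q; p] r.
    by rewrite setUC.
  have one s : side s a -> side s b -> side s c ->
      [\/ generated Fun2 [set b; c] a, generated Fun2 [set a; c] b |
          generated Fun2 [set a; b] c].
    move=> sa sb sc.
    have pN p q : side s p -> side s q -> p <> q -> proj p <> proj q.
      by move=> sp sq pq e; apply: pq; rewrite -(projK sp) e projK.
    have := ax4 _ _ _ (pN _ _ sa sb ab) (pN _ _ sa sc ac) (pN _ _ sb sc bc).
    by move=> [] g; [apply: Or31; apply: (generated_side sa sb sc)
      | apply: Or32; apply: (generated_side sb sa sc)
      | apply: Or33; apply: (generated_side sc sa sb)].
  have crossing p q : side false p = false -> side true q = false -> both p q = None.
    by move=> fp tq; rewrite /both fp tq andbF.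
  have crossing' p q : side false p = false -> side true q = false -> both q p = None.
    by move=> fp tq; rewrite /both fp tq !andbF.
  (* Unless one copy contains all three points, one of them is missing from copy [false] and another
     from copy [true]; these two cross and generate the third. *)
  case fa: (side false a); case fb: (side false b); case fc: (side false c);
    case ta: (side true a); case tb: (side true b); case tc: (side true c);
    try (by apply: (one false)); try (by apply: (one true));
    try (by have := side_or a; rewrite fa ta);
    try (by have := side_or b; rewrite fb tb);
    try (by have := side_or c; rewrite fc tc);
    first [ by apply: Or31; apply: generated_crossing; apply: crossing
          | by apply: Or31; apply: generated_crossing; apply: crossing'
          | by apply: Or32; apply: generated_crossing; apply: crossing
          | by apply: Or32; apply: generated_crossing; apply: crossing'
          | by apply: Or33; apply: generated_crossing; apply: crossing
          | by apply: Or33; apply: generated_crossing; apply: crossing' ].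
Qed.

(** Universality embeds the amalgam, and [g1], [g2] carry [E] onto its two copies. Following [g2] by
    the inverse of [g1] fixes [B], where the copies are glued, and sends the rest of [E] off [E],
    because the copies meet only over [B]. *)
Lemma two_copies_amalgam : exists k : aut Rel Fun,
  (forall b, B b -> k b = b) /\ (forall a, E a -> ~ B a -> ~ E (k a)).
Proof.
have [_ _ /(_ T Rel2 Fun2 bkl_two)[e [eI eR eF]]] := hN.
have finE : finite_set E.
  by apply: (@sub_finite_set _ _ `I_M.+1); [exact: EM|exact: finite_II].
have ext s : exists g : aut Rel Fun, forall a, E a -> g a = e (copy s a).
  apply: embedding_extends => //.
  - move=> x y /set_mem Ex /set_mem Ey /eI xy.
    by rewrite -(copyK s Ex) xy copyK.
  - move=> j a b Ea Eb; rewrite -eR (@Rel2_side s) ?copyK //; exact: side_copy.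
  - move=> i a b Ea Eb; rewrite -eF (@Fun2_side s) ?copyK //; exact: side_copy.
have [g1 g1E] := ext false; have [g2 g2E] := ext true.
exists (aut_mul (aut_inv g1) g2); split => [b Bb|a Ea Ba] /=.
  by rewrite g2E ?copyB -?g1E ?fwK//; exact: BE.
move=> Ek; have := g1E _ Ek; rewrite bwK (g2E _ Ea) => /eI.
move=> /(congr1 (fun p : T => (val p).1)); rewrite /= !val_copy //=.
  by rewrite asboolF.
by move: Ek; rewrite /= g2E.
Qed.
End TwoCopies.

(** Used with large [E] to push points off [B] far away, and with empty [B] to displace all of [E].
    The amalgam needs a default point, hence the separate case of empty [E]. *)
Lemma free_automorphism (B E : set nat) :
  Defs.fclosed Fun B -> finite_set E -> Defs.fclosed Fun E -> B `<=` E ->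
  exists k : aut Rel Fun,
    (forall b, B b -> k b = b) /\ (forall a, E a -> ~ B a -> ~ E (k a)).
Proof.
move=> cB finE cE BE.
have [->|/set0P[a0 Ea0]] := eqVneq E set0; first by exists (aut1 Rel Fun).
have [M EM] := finite_set_bound finE.
by apply: (@two_copies_amalgam B E M a0) => // a /EM /leqW.
Qed.

End Amalgamation.

(** * Meager sets, the Baire property and generic sets *)

Section Category.
Context {T : topologicalType}.
Implicit Types A B : set T.

Lemma meagerS A B : A `<=` B -> meager B -> meager A.
Proof. by move=> AB [N [Nn BN]]; exists N; split=> //; exact: subset_trans BN. Qed.

Lemma meager_bigcup (F : nat -> set T) : (forall n, meager (F n)) -> meager (\bigcup_n F n).
Proof.
move=> /choice[N NP].
exists (fun k => if unpickle k is Some (n, m) then N n m else set0); split=> [k|x].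
  case: unpickle => [[n m]|]; first exact: (NP n).1.
  by rewrite /nowhere_dense closure0 interior0.
move=> [n _ Fx]; have [m _ Nx] := (NP n).2 x Fx.
by exists (pickle (n, m)) => //; rewrite pickleK.
Qed.

Lemma nowhere_dense_meager A : nowhere_dense A -> meager A.
Proof. by move=> nA; exists (fun=> A); split=> // x Ax; exists 0. Qed.

Lemma meager0 : meager (@set0 T).
Proof. by apply: nowhere_dense_meager; rewrite /nowhere_dense closure0 interior0. Qed.

Lemma meagerU A B : meager A -> meager B -> meager (A `|` B).
Proof.
move=> mA mB; apply: meagerS (@meager_bigcup (fun n => if n is 0 then A else B) _).
  by move=> x [Ax|Bx]; [exists 0|exists 1].
by case.
Qed.

Lemma meager_exterior_boundary (U : set T) : open U -> meager (~` U `\` interior (~` U)).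
Proof.
move=> oU; apply: nowhere_dense_meager; rewrite /nowhere_dense.
have cl : closed (~` U `\` interior (~` U)).
  by apply: closedI; [exact: open_closedC|exact/open_closedC/open_interior].
rewrite -(closure_id _).1 //; apply/seteqP; split=> // x xi.
have [_] := interior_subset xi; apply; apply: interiorS xi; by move=> y [].
Qed.

Lemma open_baire_property (U : set T) : open U -> baire_property U.
Proof. by move=> oU; exists U; split=> //; rewrite setDv setU0; exact: meager0. Qed.

Lemma baire_propertyC A : baire_property A -> baire_property (~` A).
Proof.
move=> [U [oU mU]]; exists (interior (~` U)); split; first exact: open_interior.
apply: meagerS (meagerU mU (meager_exterior_boundary oU)) => x [[Ax Ux]|[Ux Ax]].
  by have [Ux'|Ux'] := pselect (U x); [left; right|right].
by left; left; split; [exact: contrapT|exact: (interior_subset Ux)].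
Qed.

Lemma baire_property_bigcup (F : nat -> set T) :
  (forall n, baire_property (F n)) -> baire_property (\bigcup_n F n).
Proof.
move=> /choice[U UP]; exists (\bigcup_n U n); split.
  by apply: bigcup_open => n _; exact: (UP n).1.
apply: meagerS (meager_bigcup (fun n => (UP n).2)) => x [[[n _ Fx] Ux]|[[n _ Ux] Fx]].
  by exists n => //; left; split=> // Unx; apply: Ux; exists n.
by exists n => //; right; split=> // Fnx; apply: Fx; exists n.
Qed.

(** Comeagerness in terms of dense open sets, the form to which coordinate substitution and the
    Baire category theorem apply. *)
Definition generic A := exists D : nat -> set T,
  (forall n, open (D n) /\ dense (D n)) /\ \bigcap_n D n `<=` A.

Lemma genericS A B : A `<=` B -> generic A -> generic B.
Proof. by move=> AB [D [DP DA]]; exists D; split=> //; exact: subset_trans AB. Qed.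

Lemma generic_bigcap (J : countType) (F : J -> set T) :
  (forall i, generic (F i)) -> generic [set x | forall i, F i x].
Proof.
move=> /choice[D DP].
exists (fun k => if unpickle k is Some (i, m) then D i m else setT); split=> [k|x Dx i].
  case: unpickle => [[i m]|]; first exact: (DP i).1.
  by split; [exact: openT|move=> O [x Ox] _; exists x].
apply: (DP i).2 => m _; have := Dx (pickle (i, m)) I.
by rewrite pickleK.
Qed.

Lemma genericI A B : generic A -> generic B -> generic (A `&` B).
Proof.
move=> gA gB; apply: genericS (@generic_bigcap bool (fun b => if b then A else B) _).
  by move=> x AB; split; [exact: (AB true)|exact: (AB false)].
by case.
Qed.

Lemma open_dense_generic A : open A -> dense A -> generic A.
Proof. by move=> oA dA; exists (fun=> A); split=> // x /(_ 0 I). Qed.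

Lemma generic_comeager A : generic A -> comeager A.
Proof.
move=> [D [DP DA]]; exists (fun n => ~` D n); split=> [n|x Ax]; last first.
  apply: contrapT => nD; apply: Ax; apply: DA => n _; apply: contrapT => Dx.
  by apply: nD; exists n.
have [oD dD] := DP n; rewrite /nowhere_dense -(closure_id _).1; last exact: open_closedC.
apply: contrapT => /eqP/set0P[x xi].
have [y [yi Dy]] := dD _ (ex_intro _ x xi) (open_interior _).
exact: (interior_subset yi).
Qed.

Lemma meager_generic A : meager A -> generic (~` A).
Proof.
move=> [N [Nn AN]]; exists (fun n => ~` closure (N n)); split=> [n|x Dx Ax].
  split; first exact/closed_openC/closed_closure.
  move=> O [x Ox] oO; apply: contrapT => nO.
  have : interior (closure (N n)) x.
    rewrite /interior nbhsE /=; exists O => // y Oy; apply: contrapT => Ny; apply: nO.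
    by exists y.
  by rewrite (Nn n).
have [n _ Nx] := AN x Ax.
by apply: (Dx n) => //; exact: subset_closure.
Qed.

End Category.

(** * Baire measurable functions and continuity on generic sets *)

Lemma baire_measurable_borel {T U : topologicalType} (G : T -> U) (A : set U) :
  baire_measurable G -> borel_set A -> baire_property (G @^-1` A).
Proof.
move=> mG; move: A; apply: (@smallest_sub _ _ _ [set B | baire_property (G @^-1` B)]) => [|B oB]; last exact: mG.
split=> [|B /= bB|F /= bF].
- by rewrite /= preimage_set0; apply: open_baire_property; exact: open0.
- by rewrite /= setTD preimage_setC; exact: baire_propertyC.
- by rewrite /= preimage_bigcup; exact: baire_property_bigcup.
Qed.

Lemma borel_fun_baire_measurable {T U : topologicalType} (G : T -> U) :
  borel_fun G -> baire_measurable G.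
Proof.
move=> bG B oB; apply: (@baire_measurable_borel T T id (G @^-1` B)); last exact: bG.
by move=> V oV; exact: open_baire_property.
Qed.

Lemma baire_measurable_comp {T U V : topologicalType} (G : T -> U) (H : U -> V) :
  baire_measurable G -> borel_fun H -> baire_measurable (H \o G).
Proof. by move=> mG bH B oB; exact: (baire_measurable_borel mG (bH B oB)). Qed.

Definition continuous_on {T U : topologicalType} (C : set T) (G : T -> U) :=
  forall x, C x -> forall A, nbhs (G x) A ->
    exists2 V, open V & V x /\ forall y, V y -> C y -> A (G y).

Lemma continuous_onS {T U : topologicalType} (C C' : set T) (G : T -> U) :
  C' `<=` C -> continuous_on C G -> continuous_on C' G.
Proof.
move=> CC cG x /CC Cx A GA; have [V oV [Vx VA]] := cG x Cx A GA.
by exists V => //; split=> // y Vy /CC; exact: VA.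
Qed.

Section RealValued.
Context {R : realType} {T : topologicalType}.

Lemma nbhs_rat_itv (u : R) A : nbhs u A ->
  exists p q : rat, [/\ (ratr p < u)%R, (u < ratr q)%R &
    forall v, (ratr p <= v <= ratr q)%R -> A v].
Proof.
move=> /nbhs_ballP[e /= e0 eA].
have [p] := @rat_in_itvoo R (u - e)%R u ltac:(by rewrite ltrBlDr ltrDl).
rewrite in_itv /= => /andP[p1 p2].
have [q] := @rat_in_itvoo R u (u + e)%R ltac:(by rewrite ltrDl).
rewrite in_itv /= => /andP[q1 q2].
exists p, q; split=> // v /andP[pv vq]; apply: eA.
by rewrite ball_itv /= in_itv /= (lt_le_trans p1 pv) (le_lt_trans vq q2).
Qed.

(** The preimage of each rational interval differs from an open set by a meager set; off these
    countably many meager sets the function is continuous. *)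
Lemma baire_measurable_continuous_on (G : T -> R) : baire_measurable G ->
  exists2 C, generic C & continuous_on C G.
Proof.
move=> mG; pose itv (pq : rat * rat) := [set v : R | ratr pq.1 < v < ratr pq.2]%R.
have oitv pq : open (itv pq).
  rewrite (_ : itv pq = [set v | ratr pq.1 < v] `&` [set v | v < ratr pq.2])%R.
    by apply: openI; [exact: open_gt|exact: open_lt].
  by apply/seteqP; split=> v; [move=> /andP[]|rewrite /itv => -[/= p1 p2]; rewrite /= p1].
have /choice[U UP] := fun pq => mG _ (oitv pq).
exists [set x | forall pq, (~` ((G @^-1` itv pq `\` U pq) `|` (U pq `\` G @^-1` itv pq))) x].
  by apply: generic_bigcap => pq; apply: meager_generic; exact: (UP pq).2.
move=> x Cx A /nbhs_rat_itv[p [q [px xq pqA]]].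
exists (U (p, q)); first exact: (UP _).1.
split=> [|y Uy Cy].
  apply: contrapT => Ux; apply: (Cx (p, q)); left; split=> //=.
  by rewrite /itv /= px xq.
apply: pqA; have : itv (p, q) (G y).
  by apply: contrapT => Gy; apply: (Cy (p, q)); right.
by rewrite /itv /= => /andP[/ltW -> /ltW ->].
Qed.

End RealValued.

(** * Boxes in the sequence space and the Baire category theorem *)

Section SequenceSpace.
Variable R : realType.
Implicit Types (x y z : RN R) (U V : set (RN R)).

Lemma continuous_coord (i : nat) : continuous (fun x : RN R => x i).
Proof. exact: (@proj_continuous nat (fun=> R) i). Qed.
Arguments continuous_coord : clear implicits.

Lemma continuous_coordwise {T : topologicalType} (F : T -> RN R) :
  (forall i, continuous (fun t => F t i)) -> continuous F.
Proof. by move=> cF t; apply/pointwise_cvgP => i; exact: cF. Qed.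

Lemma open_preimage {T : topologicalType} (F : T -> RN R) U :
  (forall i, continuous (fun t => F t i)) -> open U -> open [set t | U (F t)].
Proof. by move=> /continuous_coordwise/continuousP; apply. Qed.

Lemma open_reindex (h : nat -> nat) U : open U -> open [set x : RN R | U (x \o h)].
Proof. by apply: open_preimage => i; exact: (continuous_coord (h i)). Qed.

Definition patch (B : set nat) x y : RN R := fun j => if `[< B j >] then x j else y j.

Lemma patch_in B x y j : B j -> patch B x y j = x j.
Proof. by move=> Bj; rewrite /patch asboolT. Qed.

Lemma patch_out B x y j : ~ B j -> patch B x y j = y j.
Proof. by move=> Bj; rewrite /patch asboolF. Qed.

Lemma open_patchl B U y : open U -> open [set x | U (patch B x y)].
Proof.
apply: open_preimage => i; rewrite /patch; case: asboolP => _; last exact: cst_continuous.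
exact: continuous_coord.
Qed.

(** The list constrains an initial segment of the coordinates only, so boxes form a base indexed by
    a countable type. *)
Definition box (l : seq (rat * rat)) : set (RN R) :=
  [set x | forall i, i < size l ->
    (ratr (nth (0, 0) l i).1 < x i < ratr (nth (0, 0) l i).2)%R].

Definition clbox (l : seq (rat * rat)) : set (RN R) :=
  [set x | forall i, i < size l ->
    (ratr (nth (0, 0) l i).1 <= x i <= ratr (nth (0, 0) l i).2)%R].

Lemma box_agree l x y : (forall i, i < size l -> x i = y i) -> box l x -> box l y.
Proof. by move=> xy lx i il; rewrite -xy //; exact: lx. Qed.

Lemma nbhs_box_coord l x i : box l x -> i < size l ->
  nbhs (x i) [set v : R | (ratr (nth (0, 0) l i).1 < v < ratr (nth (0, 0) l i).2)%R].
Proof.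
move=> lx il; have /andP[p q] := lx i il.
by apply: filterS2 (lt_nbhsr p) (lt_nbhsl q) => v /= -> ->.
Qed.

Lemma open_box l : open (box l).
Proof.
rewrite openE => x lx.
pose f (i : 'I_(size l)) := [set y : RN R |
  (ratr (nth (0, 0) l i).1 < y i < ratr (nth (0, 0) l i).2)%R].
have : nbhs x [set y | forall i, f i y].
  apply: (@filter_forall _ _ f _ (nbhs_filter x)) => i.
  exact: (continuous_coord i x _ (nbhs_box_coord lx (ltn_ord i))).
by apply: filterS => y ly i il; exact: (ly (Ordinal il)).
Qed.

Lemma box_within x m (A : nat -> set R) : (forall i, i < m -> nbhs (x i) (A i)) ->
  exists l, [/\ size l = m, box l x & forall y, clbox l y -> forall i, i < m -> A i (y i)].
Proof.
move=> xA.
have /choice[pq pqP] : forall i, exists pq : rat * rat, i < m ->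
    [/\ (ratr pq.1 < x i)%R, (x i < ratr pq.2)%R &
      forall v, (ratr pq.1 <= v <= ratr pq.2)%R -> A i v].
  move=> i; have [im|_] := boolP (i < m); last by exists (0, 0)%R.
  by have [p [q H]] := nbhs_rat_itv (xA i im); exists (p, q).
exists (mkseq pq m); rewrite size_mkseq; split=> // [i|y ly i im].
  by rewrite size_mkseq => im; rewrite nth_mkseq //; have [-> ->] := pqP i im.
have [_ _] := pqP i im; apply; have := ly i; rewrite size_mkseq => /(_ im).
by rewrite nth_mkseq.
Qed.

Lemma box_clbox l : box l `<=` clbox l.
Proof. by move=> x lx i /lx /andP[/ltW -> /ltW ->]. Qed.

(** The sets that include a box around [x] form a filter. It converges to [x] coordinatewise, hence
    in the product topology, and so it contains every open set around [x]. *)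
Lemma open_box_sub x U : open U -> U x -> exists2 l, box l x & box l `<=` U.
Proof.
move=> oU Ux.
pose F : set_system (RN R) := [set A | exists2 l, box l x & box l `<=` A].
have FF : Filter F.
  split=> [|A B [l lx lA] [l' l'x lB]|A B AB [l lx lA]].
  - by exists [::].
  - pose itv (s : seq (rat * rat)) i := [set v : R | i < size s ->
      (ratr (nth (0, 0) s i).1 < v < ratr (nth (0, 0) s i).2)%R].
    have xitv s i : box s x -> nbhs (x i) (itv s i).
      move=> sx; have [il|il] := boolP (i < size s).
        by apply: filterS (nbhs_box_coord sx il) => v ? ?.
      by apply: filterS (@filterT _ (nbhs (x i)) _) => v _ /= il'; rewrite il' in il.
    have [k [sk kx kI]] := @box_within x (maxn (size l) (size l'))
      (fun i => itv l i `&` itv l' i) (fun i _ => filterI (xitv l i lx) (xitv l' i l'x)).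
    exists k => // y /box_clbox ky; split; [apply: lA|apply: lB] => i il.
      by have [|+ _] := kI y ky i; [rewrite leq_max il|exact].
    by have [|_ +] := kI y ky i; [rewrite leq_max il orbT|exact].
  - by exists l => //; exact: subset_trans AB.
have Fx : F --> x.
  apply/pointwise_cvgP => i A /= xA.
  have [l [sl lx lA]] := @box_within x i.+1 (fun j => if j == i then A else setT)
    (fun j _ => ltac:(by have [->|_] := eqVneq j i; [exact: xA|exact: filterT])).
  exists l => // y /box_clbox ly; have := lA y ly i (leqnn _).
  by rewrite eqxx.
by apply: Fx; apply: open_nbhs_nbhs.
Qed.

Lemma baire_step D l : open D -> dense D -> box l !=set0 ->
  exists l', [/\ size l < size l', box l' !=set0 & clbox l' `<=` box l `&` D].
Proof.
move=> oD dD ne.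
have [x [lx Dx]] := dD _ ne (open_box l).
have [l1 l1x l1D] := open_box_sub (openI (open_box l) oD) (conj lx Dx).
have [l' [sl' l'x l'l]] := @box_within x (maxn (size l).+1 (size l1))
  (fun i => [set v : R | i < size l1 ->
      (ratr (nth (0, 0) l1 i).1 < v < ratr (nth (0, 0) l1 i).2)%R])
  (fun i _ => ltac:(by have [il|il] := boolP (i < size l1);
     [apply: filterS (nbhs_box_coord l1x il) => v ? ?
     |apply: filterS (@filterT _ (nbhs (x i)) _) => v _ /=; rewrite ?(negbTE il)])).
exists l'; split; [by rewrite sl' leq_max leqnn|by exists x|].
move=> y l'y; apply: l1D => i il; apply: (l'l y l'y) => //.
by rewrite leq_max il orbT.
Qed.

(** Any two of the boxes share a point, so in each coordinate every left end lies below every right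
    end, and the supremum of the left ends lies in all the closed intervals. *)
Lemma nested_boxes (l : nat -> seq (rat * rat)) :
  (forall k, size (l k) < size (l k.+1)) -> (forall k, box (l k) !=set0) ->
  (forall k, box (l k.+1) `<=` box (l k)) -> exists x, forall k, clbox (l k) x.
Proof.
move=> sl ne lS.
have lD k k' : k <= k' -> box (l k') `<=` box (l k).
  move=> kk'; rewrite -(subnKC kk'); elim: (k' - k) => [|d IH]; rewrite ?addn0//.
  by rewrite addnS; exact: subset_trans (lS _) IH.
have ksl k : k <= size (l k) by elim: k => // k IH; exact: leq_ltn_trans IH (sl k).
pose L j := [set ratr (nth (0, 0)%R (l k) j).1 | k in [set k | j < size (l k)]] : set R.
have LU j k : j < size (l k) -> ubound (L j) (ratr (nth (0, 0)%R (l k) j).2).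
  move=> jk _ [k' /= jk' <-]; have [z zl] := ne (maxn k k').
  have /andP[_ /ltW z2] := lD _ _ (leq_maxl _ _) z zl j jk.
  have /andP[/ltW z1 _] := lD _ _ (leq_maxr _ _) z zl j jk'.
  exact: le_trans z1 z2.
have hsL j : has_sup (L j).
  split; first by exists (ratr (nth (0, 0)%R (l j.+1) j).1), j.+1 => //=; exact: ksl.
  by exists (ratr (nth (0, 0)%R (l j.+1) j).2); exact: LU (ksl _).
exists (fun j => sup (L j)) => k j jk; apply/andP; split.
  by apply: sup_upper_bound; [exact: hsL|exists k].
by apply: ge_sup; [exact: (hsL j).1|exact: LU].
Qed.

Lemma baire_RN (D : nat -> set (RN R)) :
  (forall n, open (D n) /\ dense (D n)) -> dense (\bigcap_n D n).
Proof.
move=> DP O [x0 Ox0] oO.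
have [l0 l0x l0O] := open_box_sub oO Ox0.
pose T := {l | box l !=set0}.
have /choice[F FP] (q : nat * T) : exists r : T,
    size (sval q.2) < size (sval r) /\ clbox (sval r) `<=` box (sval q.2) `&` D q.1.
  case: q => n [l ne]; have [l' [sl ne' l'l]] := baire_step (DP n).1 (DP n).2 ne.
  by exists (exist _ l' ne').
pose s := fix s k : T := if k is k'.+1 then F (k', s k')
  else exist _ l0 (ex_intro _ x0 l0x).
have [x xs] : exists x, forall k, clbox (sval (s k)) x.
  apply: nested_boxes => k; first exact: (FP (k, s k)).1.
    exact: (svalP (s k)).
  by move=> y /box_clbox /(FP (k, s k)).2[].
exists x; split; first by apply: l0O; have [] := (FP (0, s 0)).2 x (xs 1).
by move=> n _; have [] := (FP (n, s n)).2 x (xs n.+1).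
Qed.

Lemma generic_meets (C U : set (RN R)) : generic C -> open U -> U !=set0 ->
  exists2 x, U x & C x.
Proof.
move=> [D [DP DC]] oU U0; have [x [Ux Dx]] := baire_RN DP U0 oU.
by exists x => //; exact: DC.
Qed.

(** By injectivity each [y] is [ext y \o h], where [x0] fills the coordinates outside the range of
    [h]. An open set around [x0] pulls back along [ext] to a nonempty open set, which meets
    [D n]. *)
Lemma generic_reindex (h : nat -> nat) (C : set (RN R)) :
  injective h -> generic C -> generic [set x : RN R | C (x \o h)].
Proof.
move=> hI [D [DP DC]]; exists (fun n => [set x : RN R | D n (x \o h)]); split; last first.
  by move=> x Dx; apply: DC => n _; exact: Dx.
move=> n; split; first exact: open_reindex (DP n).1.
move=> O [x0 Ox0] oO.
have /choice[hi hiP] : forall j, exists o : option nat,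
    if o is Some a then h a = j else forall a, h a <> j.
  move=> j; have [[a <-]|nj] := pselect (exists a, h a = j); first by exists (Some a).
  by exists None => a ha; apply: nj; exists a.
pose ext (y : RN R) : RN R := fun j => if hi j is Some a then y a else x0 j.
have extK y : ext y \o h = y.
  apply/funext => a; rewrite /ext /=; have := hiP (h a).
  by case: (hi (h a)) => [b /hI ->//|/(_ a)].
have oV : open [set y | O (ext y)].
  apply: open_preimage oO => j; rewrite /ext; case: (hi j) => [a|].
    exact: continuous_coord.
  exact: cst_continuous.
have V0 : [set y | O (ext y)] !=set0.
  exists (x0 \o h) => /=; rewrite (_ : ext _ = x0) //; apply/funext => j.
  by rewrite /ext; have := hiP j; case: (hi j) => // a /= ->.
have [y [Oy Dy]] := (DP n).2 _ V0 oV.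
by exists (ext y); split=> //=; rewrite extK.
Qed.

End SequenceSpace.
Arguments box : clear implicits.

(** * Generic coincidence of functions *)

Section Separation.
Context {R : realType} {T : topologicalType}.

Lemma real_separation (u v : R) : u <> v ->
  exists A B : set R, [/\ nbhs u A, nbhs v B & forall w, A w -> B w -> False].
Proof.
have lt_sep (a b : R) : (a < b)%R ->
    exists A B : set R, [/\ nbhs a A, nbhs b B & forall w, A w -> B w -> False].
  move=> ab; pose c := ((a + b) / 2)%R.
  have [ac cb] : (a < c)%R /\ (c < b)%R by rewrite /c; split; rewrite midf_lt.
  exists [set w | (w < c)%R], [set w | (c < w)%R]; split; [exact: lt_nbhsl|exact: lt_nbhsr|].
  by move=> w /= wc /(lt_trans wc); rewrite ltxx.
move=> /eqP; rewrite neq_lt => /orP[/lt_sep//|/lt_sep[A [B [vA uB AB]]]].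
by exists B, A; split=> // w Bw Aw; exact: AB Aw Bw.
Qed.

Lemma continuous_on_neq (C : set T) (G H : T -> R) x :
  continuous_on C G -> continuous_on C H -> C x -> G x <> H x ->
  exists2 V, open V & V x /\ forall y, V y -> C y -> G y <> H y.
Proof.
move=> cG cH Cx /real_separation[A [B [uA vB AB]]].
have [V oV [Vx VA]] := cG x Cx A uA; have [W oW [Wx WB]] := cH x Cx B vB.
exists (V `&` W); first exact: openI.
split=> // y [Vy Wy] Cy GH; apply: (AB (G y)); first exact: VA.
by rewrite GH; exact: WB.
Qed.

End Separation.

Section Generic.
Context {R : realType}.
Implicit Types (C U : set (RN R)).

Lemma generic_within (U D : set (RN R)) : open D ->
  (forall O, open O -> O !=set0 -> O `<=` U -> (O `&` D) !=set0) -> open U ->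
  generic [set x | U x -> D x].
Proof.
move=> oD dD oU; apply: genericS (@open_dense_generic _ (D `|` interior (~` U)) _ _).
- by move=> x [Dx|nU] Ux //; case: (interior_subset nU Ux).
- by apply: openU => //; exact: open_interior.
- move=> O [x Ox] oO; have [[y [Oy Uy]]|nOU] := pselect ((O `&` U) !=set0).
    have [|||z [[Oz _] Dz]] := dD (O `&` U); [exact: openI|by exists y|by move=> z []|].
    by exists z; split=> //; left.
  exists x; split=> //; right; rewrite /interior nbhsE /=.
  by exists O => // z Oz Uz; apply: nOU; exists z.
Qed.

Lemma continuous_on_reindex (h : nat -> nat) C (G : RN R -> R) :
  continuous_on C G ->
  continuous_on [set x : RN R | C (x \o h)] (fun x : RN R => G (x \o h)).
Proof.
move=> cG x Cx A GA; have [V oV [Vx VA]] := cG _ Cx A GA.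
exists [set x : RN R | V (x \o h)]; first exact: open_reindex.
by split=> // y Vy; exact: VA.
Qed.

(** Disagreement at a point of [C] persists nearby on [C]. If no alternative held on an open subset
    of [U], the disagreement sets [D j] would thus all be dense in [U], and a generic point would
    satisfy no alternative. *)
Lemma generic_alternative (J : countType) (G H : J -> RN R -> R) C U :
  generic C -> (forall j, continuous_on C (G j)) -> (forall j, continuous_on C (H j)) ->
  open U -> U !=set0 -> (forall x, U x -> C x -> exists j, G j x = H j x) ->
  exists j V, [/\ open V, V !=set0, V `<=` U & forall x, V x -> C x -> G j x = H j x].
Proof.
move=> gC cG cH oU U0 cov; apply: contrapT => nex.
pose D j := \bigcup_(W in [set W | open W /\ forall y, W y -> C y -> G j y <> H j y]) W.
have gD j : generic [set x | U x -> D j x].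
  apply: generic_within => //; first by apply: bigcup_open => W [].
  move=> O oO O0 OU; apply: contrapT => nOD; apply: nex; exists j, O; split=> // x Ox Cx.
  apply: contrapT => GH; apply: nOD.
  have [V oV [Vx VN]] := continuous_on_neq (cG j) (cH j) Cx GH.
  by exists x; split=> //; exists V.
have [x Ux [Cx Dx]] := generic_meets (genericI gC (generic_bigcap gD)) oU U0.
have [j GH] := cov x Ux Cx.
by have [W [_ WN] Wx] := Dx j Ux; exact: (WN x).
Qed.

(** * Recurrence and finite supports *)

Section Recurrence.
Variables (Rel : nat -> nat -> nat -> Prop) (Fun : nat -> nat -> nat -> nat).
Variables (B : set nat) (k : nat -> aut Rel Fun).
Hypothesis kB : forall e b, B b -> k e b = b.
Hypothesis kfree : forall e a, a < e -> ~ B a -> e <= k e a.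

Lemma generic_recurrence (W : set (RN R)) : open W ->
  generic [set y | (exists z, W (patch B y z)) -> exists e, W (y \o k e)].
Proof.
move=> oW; apply: (@generic_within [set y | exists z, W (patch B y z)]
  [set y : RN R | exists e, W (y \o k e)]).
- rewrite (_ : [set y | _] = \bigcup_e [set y : RN R | W (y \o k e)]).
    by apply: bigcup_open => e _; exact: open_reindex.
  by apply/seteqP; split=> y [e We]; exists e.
- move=> O oO [x Ox] /(_ x Ox)[z Wz].
  have [l lx lO] := open_box_sub oO Ox; have [l' l'z l'W] := open_box_sub oW Wz.
  pose e := maxn (size l) (size l').
  (* Below [e] the witness copies [x], which keeps it in [O]; from [e] on it copies [z] transported
     by [k e]. As [k e] fixes [B] and sends the other points below [e] to at least [e], composing
     with [k e] gives [patch B x z] below [e]. *)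
  exists (fun j => if j < e then x j else z (bw (k e) j)); split.
    apply: lO; apply: box_agree lx => i il.
    by rewrite (leq_trans il (leq_maxl _ _)).
  exists e; apply: l'W; apply: box_agree l'z => i il /=.
  have ie : i < e := leq_trans il (leq_maxr _ _).
  have [Bi|Bi] := pselect (B i); first by rewrite patch_in // kB // ie.
  by rewrite patch_out // ltnNge kfree //= fwK.
- rewrite (_ : [set y | _] = \bigcup_z [set y | W (patch B y z)]).
    by apply: bigcup_open => z _; exact: open_patchl.
  by apply/seteqP; split=> y [z Wz]; exists z.
Qed.

(** If [phi x] and [phi y] differed, [phi] would avoid [phi x] on the generic points of some box
    around [y]. As [x] agrees with [y] on [B], recurrence brings some [x \o k e] into that box,
    although [phi (x \o k e) = phi x]. *)
Lemma generically_determined (phi : RN R -> R) (C0 U : set (RN R)) :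
  generic C0 -> continuous_on C0 phi ->
  (forall e, generic [set y : RN R | U y -> phi (y \o k e) = phi y]) ->
  exists2 C, generic C & forall x y, C x -> C y -> U x -> (forall b, B b -> x b = y b) ->
    phi x = phi y.
Proof.
move=> gC0 cphi kphi.
have gR := generic_bigcap (fun l => generic_recurrence (open_box R l)).
have gK := generic_bigcap (fun e => generic_reindex (can_inj (fwK (k e))) gC0).
have gC := genericI (genericI gC0 gK) (genericI gR (generic_bigcap kphi)).
refine (ex_intro2 _ _ _ gC _) => x y [[Cx Kx] [Rx Px]] [[Cy _] _] Ux xy; apply: contrapT.
move=> /real_separation[A [A' [xA yA' AA']]].
have [V oV [Vy VA']] := cphi y Cy A' yA'.
have [l ly lV] := open_box_sub oV Vy.
have [|e le] := Rx l.
  exists y; apply: box_agree ly => i _; have [Bi|Bi] := pselect (B i).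
    by rewrite patch_in // xy.
  by rewrite patch_out.
apply: (AA' (phi x)); first exact: nbhs_singleton xA.
by rewrite -(Px e Ux); apply: VA'; [exact: lV|exact: Kx].
Qed.

End Recurrence.
End Generic.

(** For [a] and [b] in a box, a generic [z] is found that can be turned into a point near [a]
    without changing it on [B1], and into a point near [b] without changing it on [B2]. Hence [G z]
    is near both [G a] and [G b]. *)
Lemma constant_of_disjoint_supports {R : realType} (B1 B2 : set nat) (G : RN R -> R)
    (C V : set (RN R)) :
  finite_set B1 -> finite_set B2 -> (forall b, B1 b -> ~ B2 b) ->
  generic C -> continuous_on C G -> open V -> V !=set0 ->
  (forall x y, V x -> C x -> V y -> C y -> (forall b, B1 b -> x b = y b) -> G x = G y) ->
  (forall x y, V x -> C x -> V y -> C y -> (forall b, B2 b -> x b = y b) -> G x = G y) ->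
  exists W, [/\ open W, W !=set0, W `<=` V &
    forall x y, W x -> C x -> W y -> C y -> G x = G y].
Proof.
move=> /finite_set_bound[M1 B1M] /finite_set_bound[M2 B2M] B12 gC cG oV [v Vv] G1 G2.
have [l lv lV] := open_box_sub oV Vv.
exists (box R l); split=> //; [exact: open_box|by exists v|].
move=> a b la Ca lb Cb; apply: contrapT => /real_separation[A [A' [aA bA' AA']]].
have [W1 oW1 [W1a W1A]] := cG a Ca A aA.
have [W2 oW2 [W2b W2A]] := cG b Cb A' bA'.
pose N := maxn (size l) (maxn M1 M2).
have N1 i : B1 i -> i < N by move=> /B1M iM; rewrite !leq_max iM !orbT.
have N2 i : B2 i -> i < N by move=> /B2M iM; rewrite !leq_max iM !orbT.
(* z \o i1 and z \o i2 share B1, resp. B2, with z and are otherwise read off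
   disjoint fresh coordinates, so that they can be prescribed independently. *)
pose i1 j := if `[< B1 j >] then j else N + j.*2.
pose i2 j := if `[< B2 j >] then j else N + j.*2.+1.
have i1I : injective i1.
  move=> j j'; rewrite /i1; case: asboolP => [/N1 jN|_]; case: asboolP => [/N1 jN'|_] //.
  - by move=> e; move: jN; rewrite e ltnNge leq_addr.
  - by move=> e; move: jN'; rewrite -e ltnNge leq_addr.
  - by move=> /addnI /double_inj.
have i2I : injective i2.
  move=> j j'; rewrite /i2; case: asboolP => [/N2 jN|_]; case: asboolP => [/N2 jN'|_] //.
  - by move=> e; move: jN; rewrite e ltnNge leq_addr.
  - by move=> e; move: jN'; rewrite -e ltnNge leq_addr.
  - by move=> /addnI [] /double_inj.
(* Below [N] the point follows [b] on [B2] and [a] elsewhere, so it stays in the box; from [N] on,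
   even offsets store [a] and odd offsets store [b]. *)
pose w : RN R := fun t => if t < N then (if `[< B2 t >] then b t else a t)
  else if odd (t - N) then b (t - N)./2 else a (t - N)./2.
have w1 : w \o i1 = a.
  apply/funext => j; rewrite /w /i1 /=; case: asboolP => [B1j|_].
    by rewrite N1 // asboolF //; exact: B12.
  by rewrite ltnNge leq_addr /= addKn odd_double doubleK.
have w2 : w \o i2 = b.
  apply/funext => j; rewrite /w /i2 /=; case: asboolP => [B2j|_].
    by rewrite N2 // asboolT.
  by rewrite ltnNge leq_addr /= addKn /= odd_double /= uphalf_double.
have lw : box R l w.
  move=> i il; rewrite /w (leq_trans il (leq_maxl _ _)).
  by case: asboolP => _; [exact: lb|exact: la].
(* [w] itself may fall outside [C], so a generic point near it takes its place. *)
have [||z] := @generic_meets _ _ ([set z : RN R | (W1 `&` box R l) (z \o i1)] `&`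
    [set z : RN R | (W2 `&` box R l) (z \o i2)] `&` box R l)
    (genericI gC (genericI (generic_reindex i1I gC) (generic_reindex i2I gC))).
- apply: openI; last exact: open_box.
  by apply: openI; apply: open_reindex; apply: openI => //; exact: open_box.
- by exists w; split=> //; split; rewrite /= ?w1 ?w2.
move=> [[[/= W1z lz1] [W2z lz2]] lz] [Cz [Cz1 Cz2]].
apply: (AA' (G z)).
  rewrite (G1 z (z \o i1)) //; [exact: W1A|exact: lV|exact: lV|].
  by move=> j Bj; rewrite /= /i1 asboolT.
rewrite (G2 z (z \o i2)) //; [exact: W2A|exact: lV|exact: lV|].
by move=> j Bj; rewrite /= /i2 asboolT.
Qed.

(** * Local constancy of a coordinate *)

Section LocallyConstant.
Context {R : realType}.
Variables (Rel : nat -> nat -> nat -> Prop) (Fun : nat -> nat -> nat -> nat).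
Hypothesis hN : is_NBKL2 Rel Fun.
Variables (phi : RN R -> R) (g : nat -> R -> R) (C0 : set (RN R)).
Hypothesis g0 : forall v, g 0 v = v.
Hypothesis gC0 : generic C0.
Hypothesis cg : forall n, continuous_on C0 (fun x => g n (phi x)).
Hypothesis phi_alt : forall (h : aut Rel Fun) (x : RN R),
  exists n, g n (phi x) = phi (x \o h) \/ g n (phi (x \o h)) = phi x.

Let cphi : continuous_on C0 phi.
Proof.
move=> x Cx A; rewrite -(g0 (phi x)) => /(@cg 0 x Cx)[V oV [Vx VA]].
by exists V => //; split=> // y Vy Cy; rewrite -(g0 (phi y)); exact: VA.
Qed.

Let reindexK (h : aut Rel Fun) (x : RN R) : (x \o h) \o bw h = x.
Proof. by apply/funext => j /=; rewrite bwK. Qed.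

Let reindexVK (h : aut Rel Fun) (x : RN R) : (x \o bw h) \o h = x.
Proof. by apply/funext => j /=; rewrite fwK. Qed.

Lemma automorphism_alternative (h : aut Rel Fun) (U : set (RN R)) :
  open U -> U !=set0 -> exists (b : bool) n V, [/\ open V, V !=set0, V `<=` U &
    forall x, V x -> C0 x -> C0 (x \o h) ->
      if b then g n (phi (x \o h)) = phi x else g n (phi x) = phi (x \o h)].
Proof.
move=> oU U0.
have gC := genericI gC0 (generic_reindex (can_inj (fwK h)) gC0).
have [[b n] [V [oV V0 VU VP]]] := @generic_alternative R (bool * nat)%type
  (fun bn x => g bn.2 (phi (if bn.1 then x \o h else x)))
  (fun bn x => phi (if bn.1 then x else x \o h)) _ U gC
  (fun bn => ltac:(by case: bn => -[] n /=;
     [apply: continuous_onS (continuous_on_reindex (h := h) (@cg n)) => x []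
     |apply: continuous_onS (@cg n) => x []]))
  (fun bn => ltac:(by case: bn => -[] n /=;
     [apply: continuous_onS cphi => x []
     |apply: continuous_onS (continuous_on_reindex (h := h) cphi) => x []])) oU U0
  (fun x _ _ => ltac:(by have [n [E|E]] := phi_alt h x;
     [exists (false, n)|exists (true, n)])).
exists b, n, V; split=> // x Vx Cx Chx.
by have := VP x Vx (conj Cx Chx); case: (b).
Qed.

Let Gam (l : seq (rat * rat)) (j : nat * seq (rat * rat)) : set (aut Rel Fun) :=
  [set h : aut Rel Fun | [/\ box R j.2 !=set0, box R j.2 `<=` box R l &
     generic [set x : RN R | box R j.2 x -> g j.1 (phi x) = phi (x \o h)]]].

(** If [g n] is applied on the other side, substituting [y \o bw h] for [x] turns the relation into
    the one required of the inverse of [h], on a translated set. As [h] fixes the coordinates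
    constrained by [l], this set stays inside [box R l]. *)
Let Gam_cover l (h : aut Rel Fun) : box R l !=set0 -> agree (size l) (aut1 Rel Fun) h ->
  exists j, Gam l j h \/ Gam l j (aut_inv h).
Proof.
move=> l0 h1; have [b [n [V [oV [v Vv] Vl VP]]]] := automorphism_alternative h (open_box R l) l0.
case: b VP => VP.
  have oV' : open [set y : RN R | V (y \o bw h)] by exact: open_reindex.
  have [|l' l'v l'V] := @open_box_sub _ (v \o h) _ oV'; first by rewrite /= reindexK.
  exists (n, l'); right; split=> /=; [by exists (v \o h)| |].
    move=> y /l'V /Vl; apply: box_agree => i il /=.
    by rewrite (h1 i il).2.
  have := genericI gC0 (generic_reindex (can_inj (bwK h)) gC0).
  apply: genericS => y [/= Cy Cy'] /l'V Vy; have := VP _ Vy Cy'.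
  by rewrite reindexVK; exact.
have [l' l'v l'V] := open_box_sub oV Vv.
exists (n, l'); left; split=> /=; [by exists v|exact: subset_trans Vl|].
have := genericI gC0 (generic_reindex (can_inj (fwK h)) gC0).
by apply: genericS => y [/= Cy Cy'] /l'V Vy; exact: VP.
Qed.

Let Gam_dense l : box R l !=set0 -> exists j h m,
  [/\ size l <= m, agree (size l) (aut1 Rel Fun) h & agree_dense (Gam l j) m h].
Proof.
move=> l0.
pose Gam2 (bj : bool * (nat * seq (rat * rat))) : set (aut Rel Fun) :=
  [set h | if bj.1 then Gam l bj.2 h else Gam l bj.2 (aut_inv h)].
have [|[[] j] [h [m [lm h1 hd]]]] := @aut_baire Rel Fun _ Gam2 (aut1 Rel Fun) (size l).
- move=> h h1; have [j [Gh|Gh]] := Gam_cover l0 h1; first by exists (true, j).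
  by exists (false, j).
- by exists j, h, m.
exists j, (aut_inv h), m; split=> //; first exact: (agree_inv h1).
move=> g' m' hg'; have [k Gk gk] := hd (aut_inv g') m' (agree_inv hg').
by exists (aut_inv k) => //; exact: (agree_inv gk).
Qed.

(** Two members [h1], [h'] of the same [Gam l (n, l')] satisfy [phi (x \o h1) = g n (phi x) = phi (x
    \o h')] generically on [box R l'], so [h'] followed by the inverse of [h1] preserves [phi] on a
    translate. Density of [Gam] supplies [h'] for which this composite copies a free automorphism
    over [B] on any given finite set. *)
Lemma exists_support (U : set (RN R)) : open U -> U !=set0 ->
  exists U' (B : set nat) (k : nat -> aut Rel Fun),
    [/\ open U', U' !=set0 & U' `<=` U] /\
    [/\ finite_set B, Defs.fclosed Fun B &
        forall x y, (forall b, B b -> x b = y b) -> U' x -> U' y] /\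
    [/\ forall e b, B b -> k e b = b, forall e a, a < e -> ~ B a -> e <= k e a &
        forall e, generic [set y : RN R | U' y -> phi (y \o k e) = phi y]].
Proof.
move=> oU [u Uu]; have [l lu lU] := open_box_sub oU Uu.
have [[n l'] [h0 [m [lm h01 hd]]]] := Gam_dense (ex_intro _ u lu).
have [h1 [/= [v l'v] l'l gh1] h01m] := hd h0 m (@agree_refl _ _ m h0).
pose m1 := maxn m (size l').
(* Fixing the points below [m] and their preimages keeps [h1 \o k0] in the neighbourhood where [Gam]
   is dense; the preimages of the points below [size l'] are the coordinates on which the translated
   box depends. *)
pose B := generated Fun (`I_m1 `|` bw h1 @` `I_m1).
have finB : finite_set B.
  apply: (finite_generated hN); rewrite finite_setU; split; first exact: finite_II.
  exact/finite_image/finite_II.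
have mB i : i < m1 -> B i by move=> im; apply: sub_generated; left.
have bB i : i < m1 -> B (bw h1 i) by move=> im; apply: sub_generated; right; exists i.
exists [set y : RN R | box R l' (y \o bw h1)], B.
have h1l i : i < size l -> bw h1 i = i.
  by move=> il; exact: (agree_trans h01 (agreeW lm h01m) il).2.
have /choice[k kP] : forall e, exists k : aut Rel Fun,
    [/\ forall b, B b -> k b = b, forall a, a < e -> ~ B a -> e <= k a &
        generic [set y : RN R | box R l' (y \o bw h1) -> phi (y \o k) = phi y]].
  move=> e; pose E := generated Fun (B `|` `I_e).
  have finE : finite_set E.
    by apply: (finite_generated hN); rewrite finite_setU; split=> //; exact: finite_II.
  have BE : B `<=` E by move=> b Bb; apply: sub_generated; left.
  have [k0 [k0B k0E]] := free_automorphism hN (@fclosed_generated _ Fun _) finE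
    (@fclosed_generated _ Fun _) BE.
  have [M EM] := finite_set_bound finE.
  have [|h' [_ _ gh'] h'M] := hd (aut_mul h1 k0) M.
    apply: agree_trans h01m _ => j jm /=.
    have jm1 : j < m1 by rewrite leq_max jm.
    by rewrite k0B; [rewrite -{1}(k0B _ (bB j jm1)) fwK|exact: mB].
  have kk0 a : E a -> aut_mul (aut_inv h1) h' a = k0 a.
    by move=> /EM /h'M[/= -> _]; rewrite fwK.
  exists (aut_mul (aut_inv h1) h'); split.
  - by move=> b Bb; rewrite kk0; [exact: k0B|exact: BE].
  - move=> a ae Ba; have Ea : E a by apply: sub_generated; right.
    rewrite kk0 // leqNgt; apply/negP => ke; apply: (k0E a Ea Ba).
    by apply: sub_generated; right.
  - have := generic_reindex (can_inj (bwK h1)) (genericI gh1 gh').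
    apply: genericS => y [/= H1 H2] ly.
    by have := H1 ly; rewrite reindexVK (H2 ly).
exists k; split; [split|split; split].
- exact/open_reindex/open_box.
- by exists (v \o h1); rewrite /= reindexK.
- move=> y /l'l ly; apply: lU; apply: box_agree ly => i il /=.
  by rewrite h1l.
- exact: finB.
- exact: fclosed_generated.
- move=> x y xy; apply: box_agree => i il /=; apply: xy.
  exact: (bB i (leq_trans il (leq_maxr _ _))).
- by move=> e; have [] := kP e.
- by move=> e; have [] := kP e.
- by move=> e; have [] := kP e.
Qed.

(** With [k] moving the support [B] off itself, [phi x] and [phi (x \o k)] depend on disjoint finite
    sets of coordinates, yet one is [g n] of the other. That one depends on either set alone and is
    therefore locally constant. *)
Lemma locally_constant (U : set (RN R)) : open U -> U !=set0 ->
  exists V C, [/\ open V, V !=set0, V `<=` U & generic C] /\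
    forall x y, V x -> C x -> V y -> C y -> phi x = phi y.
Proof.
move=> oU U0.
have [U' [B [kk [[oU' [u U'u] U'U] [[finB cB depU] [kkB kkfree kkphi]]]]]] :=
  exists_support oU U0.
have [C1 gC1 C1P] := generically_determined kkB kkfree gC0 cphi kkphi.
have [k [_ kB]] := free_automorphism hN (B := set0) (E := B) (fun i a b F _ => F) finB cB
  (@sub0set _ _).
have {}kB b : B b -> ~ B (k b) by move=> Bb; exact: kB.
pose O := U' `&` [set x : RN R | U' (x \o k)].
have oO : open O by apply: openI => //; exact: open_reindex.
have O0 : O !=set0.
  (* Membership in [U'] depends on [B] only, so the two conditions constrain [B] and its image under
     [k], which are disjoint. *)
  exists (patch B u (u \o bw k)); split; apply: depU U'u => b Bb.
    by rewrite patch_in.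
  by rewrite /= patch_out ?fwK //=; [rewrite fwK|exact: kB].
have [b [n [V [oV V0 VO VP]]]] := automorphism_alternative k oO O0.
pose C := (C0 `&` C1) `&` [set x : RN R | (C0 `&` C1) (x \o k)].
have gC : generic C.
  have g01 := genericI gC0 gC1.
  by apply: genericI => //; exact: (generic_reindex (can_inj (fwK k)) g01).
have detB x y : V x -> C x -> V y -> C y -> (forall c, B c -> x c = y c) -> phi x = phi y.
  by move=> /VO[Ux _] [[_ Cx] _] Vy [[_ Cy] _]; exact: C1P.
have detkB x y : V x -> C x -> V y -> C y -> (forall c, (k @` B) c -> x c = y c) ->
    phi (x \o k) = phi (y \o k).
  move=> /VO[_ Ux] [_ [_ Cx]] Vy [_ [_ Cy]] xy; apply: C1P => // c Bc.
  by apply: xy; exists c.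
have dis c : B c -> ~ (k @` B) c by move=> Bc [d Bd dc]; apply: (kB d Bd); rewrite dc.
have fink : finite_set (k @` B) by exact: finite_image.
case: b VP => VP.
  have [||W [oW W0 WV WP]] := @constant_of_disjoint_supports R B (k @` B) phi C V
    finB fink dis gC _ oV V0 detB.
  - by apply: continuous_onS cphi => x [[]].
  - move=> x y Vx Cx Vy Cy xy.
    rewrite -(VP x Vx Cx.1.1 Cx.2.1) -(VP y Vy Cy.1.1 Cy.2.1).
    by congr g; exact: detkB.
  exists W, C; split=> //; split=> //.
  by move=> x /WV /VO[/U'U].
have [||W [oW [w Ww] WV WP]] := @constant_of_disjoint_supports R B (k @` B)
  (fun x => phi (x \o k)) C V finB fink dis gC _ oV V0 _ detkB.
- by apply: continuous_onS (continuous_on_reindex (h := k) cphi) => x [_ []].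
- move=> x y Vx Cx Vy Cy xy.
  rewrite -(VP x Vx Cx.1.1 Cx.2.1) -(VP y Vy Cy.1.1 Cy.2.1).
  by congr g; exact: detB.
(* Here [phi (x \o k)] is constant on [W]; composing with the inverse of [k] makes this constancy of
   [phi]. *)
exists [set y : RN R | W (y \o bw k)], [set y : RN R | C (y \o bw k)]; split.
  split; [exact: open_reindex|by exists (w \o k); rewrite /= reindexK| |].
    by move=> y /WV /VO[_ /=]; rewrite reindexVK => /U'U.
  exact: generic_reindex (can_inj (bwK k)) gC.
move=> x y Wx Cx Wy Cy; have := WP _ _ Wx Cx Wy Cy.
by rewrite !reindexVK.
Qed.

End LocallyConstant.

(** * Generic ergodicity and non-reducibility *)

Section Ergodicity.
Context {R : realType}.
Variables (f : nat -> R -> R).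
Variables (Rel : nat -> nat -> nat -> Prop) (Fun : nat -> nat -> nat -> nat).
Hypothesis bf : forall n, @borel_fun R R (f n).
Hypothesis hN : is_NBKL2 Rel Fun.

Lemma generically_ergodic_E_Aut :
  generically_ergodic (@E_Aut R Rel Fun) (Zset f) (@eqplus R).
Proof.
move=> F mF FZ FE.
have rangeF (h : aut Rel Fun) (x : RN R) : range (F (x \o h)) = range (F x).
  by apply: FE; exists h; split=> //; exact: is_automorphism_aut.
(* Index [0] is the identity, so that equality counts among the alternatives. *)
pose g n : R -> R := if n is n'.+1 then f n' else id.
have mphi i n : baire_measurable (fun x => g n (F x i)).
  have mi : baire_measurable (fun x => F x i).
    move=> B oB; apply: (mF [set y : RN R | B (y i)]).
    by move: oB; apply: open_comp => x _; exact: continuous_coord.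
  by case: n => // n; exact: (baire_measurable_comp mi (bf n)).
have phi_alt i (h : aut Rel Fun) (x : RN R) :
    exists n, g n (F x i) = F (x \o h) i \/ g n (F (x \o h) i) = F x i.
  have [j _ ji] : range (F x) (F (x \o h) i) by rewrite -(rangeF h); exists i.
  have [e|ne] := pselect (F x i = F x j); first by exists 0; left; rewrite -ji.
  have [_ cl] := FZ x.
  have [||n fn] := cl (F x i) (F x j) _ _ ne; [by exists i|by exists j|].
  by exists n.+1; rewrite -ji /=; case: fn; [left|right].
have loc i (U : set (RN R)) : open U -> U !=set0 ->
    exists V C, [/\ open V, V !=set0, V `<=` U & generic C] /\
      forall x y, V x -> C x -> V y -> C y -> F x i = F y i.
  have /choice[C0 C0P] n : exists C, generic C /\ continuous_on C (fun x => g n (F x i)).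
    by have [C gC cC] := baire_measurable_continuous_on (mphi i n); exists C.
  apply: (locally_constant hN (g := g) (C0 := [set x | forall n, C0 n x])) => //.
  - by apply: generic_bigcap => n; exact: (C0P n).1.
  - by move=> n; apply: continuous_onS (C0P n).2 => x.
(* For each [i] and each box, [v] stores an open set inside the box, a generic set, and the constant
   value of [F x i] on their intersection; an empty box gets some nonempty open set. *)
have /choice[v vP] (q : nat * seq (rat * rat)) : exists v : set (RN R) * set (RN R) * R,
    [/\ open v.1.1, v.1.1 !=set0, generic v.1.2, box R q.2 !=set0 -> v.1.1 `<=` box R q.2 &
      forall x, v.1.1 x -> v.1.2 x -> F x q.1 = v.2].
  case: q => i l.
  have [U [oU U0 Ul]] : exists U, [/\ open U, U !=set0 & box R l !=set0 -> U `<=` box R l].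
    have [l0|nl0] := pselect (box R l !=set0).
      by exists (box R l); split; [exact: open_box|exact: l0|move=> _ x].
    by exists setT; split=> //; [exact: openT|exists (fun=> 0%R)].
  have [V [C [[oV V0 VU gC] VC]]] := loc i U oU U0.
  have [x Vx Cx] := generic_meets gC oV V0.
  exists (V, C, F x i); split=> //= [l0|y Vy Cy]; first exact: subset_trans (Ul l0).
  exact: VC.
have /choice[k kP] e : exists k : aut Rel Fun, forall a, a < e -> e <= k a.
  have [k [_ kE]] := free_automorphism hN (B := set0) (fun i a b F _ => F)
    (finite_generated hN (finite_II e)) (@fclosed_generated _ Fun _) (@sub0set _ _).
  exists k => a ae; rewrite leqNgt; apply/negP => ke.
  by apply: (kE a) => //; apply: sub_generated.
have ov q : open (v q).1.1 by have [] := vP q.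
have gv q : generic (v q).1.2 by have [] := vP q.
have gR := generic_bigcap (fun q => generic_recurrence (B := set0) (k := k)
  (fun e b => @False_ind _) (fun e a ae _ => kP e a ae) (ov q)).
have gC := generic_bigcap (fun q : nat * seq (rat * rat) => generic_bigcap (fun e =>
  generic_reindex (can_inj (fwK (k e))) (gv q))).
have gC1 := generic_bigcap gv.
have gV : generic [set x | forall i, exists l, (v (i, l)).1.1 x].
  apply: generic_bigcap => i.
  apply: (@open_dense_generic _ [set x | exists l, (v (i, l)).1.1 x]).
    rewrite (_ : [set x | _] = \bigcup_l (v (i, l)).1.1).
      by apply: bigcup_open => l _; exact: ov.
    by apply/seteqP; split=> x [l]; exists l.
  move=> O [x Ox] oO; have [l lx lO] := open_box_sub oO Ox.
  have [_ [y Vy] _ Vl _] := vP (i, l).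
  by exists y; split; [apply/lO/Vl => //; exists x|exists l].
pose c q := (v q).2.
(* Each [F x i] is a value of [c] because [x] lies in the open set of some [v (i, l)]. Conversely
   the orbit of [x] enters the open set of every [v q], and [F] has the same range along the
   orbit. *)
have rangeE x : [set x | forall i, exists l, (v (i, l)).1.1 x] x ->
    (forall q, (v q).1.2 x) -> (forall q, [set y | (exists z, (v q).1.1 (patch set0 y z)) ->
      exists e, (v q).1.1 (y \o k e)] x) ->
    (forall q e, (v q).1.2 (x \o k e)) -> range (F x) = range c.
  move=> Vx C1x Rx Cx; apply/seteqP; split=> [_ [i _ <-]|_ [q _ <-]].
    have [l Vl] := Vx i; exists (i, l) => //.
    by have [_ _ _ _ ->] := vP (i, l).
  have [_ [z Vz] _ _ Vc] := vP q.
  have [|e Ve] := Rx q.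
    exists z; rewrite (_ : patch _ _ _ = z) //; apply/funext => j.
    by rewrite patch_out.
  by rewrite -(rangeF (k e)); exists q.1 => //; exact: Vc.
have gA := genericI (genericI gV gC1) (genericI gR gC).
refine (ex_intro _ _ (conj (generic_comeager gA) _)).
move=> x y [[Vx C1x] [Rx Cx]] [[Vy C1y] [Ry Cy]].
by rewrite /eqplus (rangeE x) // (rangeE y).
Qed.

Lemma generic_neq_coord (i : nat) (r : R) : generic [set x : RN R | x i <> r].
Proof.
apply: open_dense_generic.
  have oN : open [set u : R | u <> r].
    rewrite (_ : [set u | _] = [set u | u != r]); first exact: open_neq.
    by apply/seteqP; split=> u /eqP.
  by move: oN; apply: open_comp => x _; exact: continuous_coord.
move=> O [x Ox] oO.
pose upd (u : R) : RN R := fun j => if j == i then u else x j.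
have oA : open [set u | O (upd u)].
  apply: open_preimage oO => j; rewrite /upd; case: eqP => _.
    by move=> u; exact: cvg_id.
  exact: cst_continuous.
have [|p [q [px xq pqO]]] := @nbhs_rat_itv R (x i) [set u | O (upd u)].
  apply: open_nbhs_nbhs; split=> //=; rewrite (_ : upd _ = x) //.
  by apply/funext => j; rewrite /upd; case: eqP => // ->.
have pq := lt_trans px xq.
have [e|ne] := pselect (ratr p = r :> R); last first.
  by exists (upd (ratr p)); split; rewrite /= /upd ?eqxx //; apply: pqO; rewrite lexx ltW.
exists (upd (ratr q)); split; first by apply: pqO; rewrite lexx ltW.
by rewrite /= /upd eqxx => e'; move: pq; rewrite e e' ltxx.
Qed.

(** By ergodicity a reduction would put a comeager set into one orbit. Points in the orbit of [x0]
    have coordinate [0] among the countably many values of [x0], which a generic point avoids. *)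
Lemma E_Aut_not_reducible :
  ~ borel_reducible (@E_Aut R Rel Fun) (Zset f) (@eqplus R).
Proof.
move=> [F [bF [FZ FE]]].
have [|C [/meager_generic cC CF]] :=
  generically_ergodic_E_Aut (borel_fun_baire_measurable bF) FZ.
  by move=> x x' /FE.
rewrite setCK in cC.
have [x0 _ Cx0] := generic_meets cC openT (ex_intro _ (fun=> 0%R : R) I).
have gN := generic_bigcap (fun j => generic_neq_coord 0 (x0 j)).
have [x _ [Cx Nx]] := generic_meets (genericI cC gN) openT (ex_intro _ x0 I).
have [h [/aut_is_automorphism[g <-] gx]] := (FE x0 x).2 (CF _ _ Cx0 Cx).
by apply: (Nx (bw g 0)); rewrite -gx bwK.
Qed.

End Ergodicity.

Theorem theorem1p4 (R : realType) (f : nat -> R -> R)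
    (Rel : nat -> nat -> nat -> Prop) (Fun : nat -> nat -> nat -> nat) :
  (forall n, @borel_fun R R (f n)) ->
  (exists C : set R, clique (fn_graph f) C /\ card_eq_aleph1 C) ->
  (forall C : set R, clique (fn_graph f) C -> card_le_aleph1 C) ->
  is_NBKL2 Rel Fun ->
  generically_ergodic (@E_Aut R Rel Fun) (Zset f) (@eqplus R) /\
  ~ borel_reducible (@E_Aut R Rel Fun) (Zset f) (@eqplus R).
Proof.
move=> bf _ _ hN; split; first exact: generically_ergodic_E_Aut.
exact: E_Aut_not_reducible.
Qed.
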